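(* Let $T>0$, let $\phi\in L^1[0,T]$ be a real-valued function that is bounded on $[0,T]$, and let $f\in AC[0,T]$. Let $$D_\phi f(t) := \int_0^t \phi(t-\tau) f'(\tau)\,d\tau,\qquad 0<t\le T.$$ Then $$\lim_{t\to 0^+} D_\phi f(t) = 0.$$
   Context: $L^1[0,T]$ is the space of Lebesgue-integrable functions on $[0,T]$. $AC[0,T]$ is the space of absolutely continuous functions on $[0,T]$: $f\in AC[0,T]$ if and only if $f(t)=f(0)+\int_0^t f'(s)\,ds$ for $0\le t\le T$ with some $f'\in L^1[0,T]$. *)

(* Defs.v *)
From mathcomp Require Import all_boot all_order all_algebra.
From mathcomp Require Import all_classical all_reals all_analysis.

Set Implicit Arguments.
Unset Strict Implicit.
Unset Printing Implicit Defensive.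

Import Order.TTheory GRing.Theory Num.Theory.
Import numFieldNormedType.Exports.

Local Open Scope classical_set_scope.
Local Open Scope ring_scope.

(* [lebesgue_measure] lives on the Borel sigma-algebra; its completion is used
   here so that measurability and integrability are those of Lebesgue. Functions
   on [0, T] are represented by total functions on R whose values outside
   [0, T] are irrelevant. *)
Definition Lebesgue_L1 (R : realType) (T : R) (g : R -> R) : Prop :=
  (@completed_lebesgue_measure R).-integrable `[0, T] (EFin \o g).

Definition Lebesgue_int (R : realType) (a b : R) (g : R -> R) : R :=
  \int[@completed_lebesgue_measure R]_(x in `[a, b]) g x.

Definition is_AC_derivative (R : realType) (T : R) (f f' : R -> R) : Prop :=
  Lebesgue_L1 T f' /\
  forall t : R, 0 <= t <= T -> f t = f 0 + Lebesgue_int 0 t f'.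

Definition abs_cont_on (R : realType) (T : R) (f : R -> R) : Prop :=
  exists f' : R -> R, is_AC_derivative T f f'.

(* [f'] stands for a derivative of an absolutely continuous [f]; it is unique
   only up to a null set, which does not affect the integral. *)
Definition D_conv (R : realType) (phi f' : R -> R) (t : R) : R :=
  Lebesgue_int 0 t (fun tau => phi (t - tau) * f' tau).

(* Main.v *)
(* Since [phi] is bounded by some [M] on [0, T], [|D_phi f t|] is at most [M]
   times the integral of [|f'|] over [0, t], which tends to [0] by absolute
   continuity of the integral. *)
Require Import Defs.
From mathcomp Require Import all_boot all_order all_algebra.
From mathcomp Require Import all_classical all_reals all_analysis.
From mathcomp Require Import lra.

Import Order.TTheory GRing.Theory Num.Theory.
Import numFieldNormedType.Exports.

Local Open Scope classical_set_scope.
Local Open Scope ring_scope.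

Section integral_domination.
Local Open Scope ereal_scope.
Context d (T : measurableType d) (R : realType) (mu : {measure set T -> \bar R}).
Implicit Types (D : set T) (f g : T -> \bar R).

(** Used with [a] and [b] the integrals of the positive and negative parts and [c] the integral of
    the dominating function. *)
Lemma abse_sub_le_ge0 (a b c : \bar R) :
  0 <= a -> 0 <= b -> a <= c -> b <= c -> `|a - b| <= c.
Proof.
move: a b c => [a| |] [b| |] [c| |] //=; rewrite ?leey// ?lee_fin => *.
by rewrite ler_norml; apply/andP; split; lra.
Qed.

(* The integral of a nonnegative function is a supremum over the simple
   functions below it, so no measurability is needed; in particular one need not
   show that [phi (t - tau)] is measurable for the completed measure. *)
Lemma ge0_le_integral_nonmeasurable D f g :
  (forall x, D x -> 0 <= f x) -> (forall x, D x -> f x <= g x) ->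
  \int[mu]_(x in D) f x <= \int[mu]_(x in D) g x.
Proof.
move=> f0 fg; rewrite !ge0_integralE//; last first.
  by move=> x Dx; exact: le_trans (f0 x Dx) (fg x Dx).
apply: ereal_sup_le => _ [h hf <-]; exists h => // x.
exact: le_trans (hf x) (lee_restrict fg x).
Qed.

(** The integral is by definition that of the positive part minus that of the negative part; both
    lie between 0 and the integral of [g], which therefore bounds their difference. *)
Lemma abse_integral_le_nonmeasurable D f g :
  (forall x, D x -> `|f x| <= g x) ->
  `|\int[mu]_(x in D) f x| <= \int[mu]_(x in D) g x.
Proof.
move=> fg; rewrite integralE; apply: abse_sub_le_ge0.
- exact: integral_ge0.
- exact: integral_ge0.
- apply: ge0_le_integral_nonmeasurable => // x Dx.
  by rewrite (le_trans _ (fg x Dx))// funeposE ge_max lee_abs abse_ge0.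
- apply: ge0_le_integral_nonmeasurable => // x Dx.
  by rewrite (le_trans _ (fg x Dx))// funenegE ge_max -abseN lee_abs abse_ge0.
Qed.

Lemma normr_Rintegral_le_nonmeasurable D (f g : T -> R) :
  measurable D -> mu.-integrable D (EFin \o g) ->
  (forall x, D x -> `|f x| <= g x)%R ->
  (`|\int[mu]_(x in D) f x| <= \int[mu]_(x in D) g x)%R.
Proof.
move=> mD ig fg.
have gfin := integrable_fin_num mD ig.
have fgE : `|\int[mu]_(x in D) (f x)%:E| <= \int[mu]_(x in D) (g x)%:E.
  by apply: abse_integral_le_nonmeasurable => x Dx; rewrite lee_fin fg.
(* The bound [fgE] forces finiteness, so [fine] does not replace an infinite value by its default
   0. *)
have ffin : \int[mu]_(x in D) (f x)%:E \is a fin_num.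
  by rewrite -abse_fin_num ge0_fin_numE// (le_lt_trans fgE)// ltey_eq gfin.
by rewrite /Rintegral -fine_abse// fine_le// abse_fin_num.
Qed.

End integral_domination.

Lemma completed_measurable_itv (R : realType) (i : interval R) :
  (@wlength R idfun)^*%mu.-cara.-measurable [set` i].
Proof. by apply: sub_caratheodory; exact: measurable_itv. Qed.

(** Absolute continuity of the integral, applied to [g] extended by 0 outside [[0, T]] and to the
    sets [[0, t]], of measure [t]. *)
Lemma Lebesgue_int_normr_near0 (R : realType) (T : R) (g : R -> R) (e : R) :
  0 < T -> 0 < e -> Lebesgue_L1 T g ->
  \forall t \near 0^'+, Lebesgue_int 0 t (fun x => `|g x|) < e.
Proof.
move=> T0 e0 gL1.
have : (@completed_lebesgue_measure R).-integrable setT (EFin \o g \_ `[0, T]).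
  rewrite -restrict_EFin; apply/integrable_restrict => //=; last by rewrite setTI.
  exact: completed_measurable_itv.
move=> /integral_normr_continuous /(_ _ e0)[d [d0 /= small]].
near=> t.
have t0 : 0 < t by near: t; exact: nbhs_right_gt.
have tT : t <= T by near: t; exact: nbhs_right_le.
have td : t < d by near: t; exact: nbhs_right_lt.
have mt : (completed_lebesgue_measure `[0%R, t] < d%:E)%E.
  (* Both measures are the same outer measure on different sigma-algebras, so their values are
     convertible. *)
  rewrite -[ltLHS]/(lebesgue_measure `[0%R, t]) lebesgue_measure_itv/=.
  by rewrite lte_fin t0 sube0 lte_fin.
apply: le_lt_trans (small _ _ mt); last first.
  exact: completed_measurable_itv.
rewrite /Lebesgue_int le_eqVlt; apply/orP; left; apply/eqP/eq_Rintegral => x.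
rewrite inE/= in_itv/= => /andP[x0 xt].
by rewrite patchE mem_set//= in_itv/= x0 (le_trans xt).
Unshelve. all: by end_near. Qed.

Theorem theorem3p1 (R : realType) (T : R) (phi f : R -> R)
  (T_gt0 : 0 < T)
  (phi_L1 : Lebesgue_L1 T phi)
  (phi_bounded : [bounded phi x | x in `[0, T]])
  (f_AC : abs_cont_on T f) :
  forall f' : R -> R, is_AC_derivative T f f' ->
    D_conv phi f' t @[t --> 0^'+] --> (0 : R).
Proof.
move=> f' [f'L1 _].
(* A positive [M] makes [e / M] a valid threshold for the integral of [|f'|]. *)
have [M M0 phiM] := pinfty_ex_gt0 phi_bounded.
apply/cvgr0Pnorm_lt => e e0.
near=> t.
have tT : t <= T by near: t; exact: nbhs_right_le.
have mt := completed_measurable_itv R `[0, t].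
have if' : (@completed_lebesgue_measure R).-integrable `[0, t]
    (EFin \o (fun x => `|f' x|)).
  rewrite [X in integrable _ _ X](_ : _ = abse \o (EFin \o f'))//.
  apply: integrable_abse.
  apply: (integrableS _ _ _ f'L1) => //.
    exact: completed_measurable_itv.
  by apply: subset_itvl; rewrite bnd_simp.
apply: (@le_lt_trans _ _ (Lebesgue_int 0 t (fun x => M * `|f' x|))).
  apply: normr_Rintegral_le_nonmeasurable => //.
    exact: (integrableZl mt M if').
  move=> x /=; rewrite in_itv/= => /andP[x0 xt].
  (* As [0 <= x <= t <= T], the point [t - x] lies in [[0, T]], where [M] bounds [|phi|]. *)
  rewrite normrM ler_wpM2r// phiM//= in_itv/=.
  by apply/andP; split; lra.
rewrite /Lebesgue_int RintegralZl// mulrC -ltr_pdivlMr//.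
near: t.
exact: (Lebesgue_int_normr_near0 _ _ _ _ T_gt0 (divr_gt0 e0 M0) f'L1).
Unshelve. all: by end_near. Qed.
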